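(* Let $F$ be a dense supertropical semifield. Then the monoid $\mathrm{SLS}_n^{\mathbf 1}$ is a maximal nonsingular submonoid of $\mathrm{SLS}_n(F)$.
   Context: A supertropical semifield is a semiring $F$ (with zero $\mathbf 0$ and unit $\mathbf 1$) with a multiplicative submonoid $\mathcal T\subset F$ (tangible elements) that is an abelian group, a set $\mathcal G$ (ghost elements) such that $\mathcal G_0:=\mathcal G\cup\{\mathbf 0\}$ is an ordered semiring ideal of $F$, with $F=\mathcal T\cup\mathcal G_0$ (disjoint union), and a map $\nu:F\to\mathcal G_0$ with $\nu^2=\nu$, $\nu(ab)=\nu(a)b=a\nu(b)=\nu(a)\nu(b)$, $\nu(\mathcal T)=\mathcal G$, and $a+b=a$ if $\nu(a)>\nu(b)$, $a+b=\nu(a)$ if $\nu(a)=\nu(b)$. Write $a>_\nu b$ if $\nu(a)>\nu(b)$, and similarly $\ge_\nu,<_\nu,\le_\nu$; $a\cong_\nu b$ if $\nu(a)=\nu(b)$. $F$ is dense if whenever $a>_\nu b$ in $F$ there is $u<_\nu\mathbf 1$ with $ua>_\nu b$. The tropical determinant of $A=(a_{i,j})\in\mathrm{Mat}_n(F)$ is $\det(A)=\sum_{\pi\in S_n}\prod_{i=1}^n a_{i,\pi(i)}$ (no signs); $A$ is nonsingular if $\det(A)\in\mathcal T$. $\mathrm{SLS}_n(F)=\{A\in\mathrm{Mat}_n(F):\det(A)=\mathbf 1\}$ (not itself closed under multiplication); a submonoid of it is a subset containing the identity matrix and closed under matrix multiplication. A matrix monoid is nonsingular if all its elements are nonsingular.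 Maximality is with respect to inclusion. A permutation $\pi$ is dominant for $A$ if $\det(A)\cong_\nu\prod_i a_{i,\pi(i)}$. $A$ is strictly normal if the identity is the unique dominant permutation, $a_{i,i}=\mathbf 1$ for all $i$, and $a_{i,j}<_\nu\mathbf 1$ for all $i\ne j$. Permutation matrices $P_\pi$ have $(i,j)$ entry $\mathbf 1$ if $j=\pi(i)$ and $\mathbf 0$ otherwise. $\mathrm{SLS}_n^{\mathbf 1}=\{PJQ: J\in\mathrm{Mat}_n(F)\text{ strictly normal},\ P,Q\text{ permutation matrices}\}$.
   Formalization: The formal theorem additionally assumes that ν is injective on the tangible elements T; without this the claim fails for every n ≥ 2 (e.g. T = {±1}×Q_{>0}, where diag(−1,−1) lies in a larger nonsingular submonoid). *)

(* Defs.v *)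
From HB Require Import structures.
From mathcomp Require Import all_boot all_order all_algebra all_fingroup.
From mathcomp Require Import classical_sets.

Set Implicit Arguments.
Unset Strict Implicit.
Unset Printing Implicit Defensive.

Import GRing.Theory.
Local Open Scope ring_scope.

Definition with_zero (F : pzSemiRingType) (G : {pred F}) : {pred F} :=
  [pred x | (x == 0) || (x \in G)].

(* [leG] is a relation on the whole of F, but only its restriction to           *)
(* G_0 = G U {0} is constrained or used.                                        *)
HB.mixin Record isSupertropicalSemifield F of GRing.PzSemiRing F := {
  tangible : {pred F};
  ghost : {pred F};
  nu : F -> F;
  leG : rel F;
  tangible1 : 1 \in tangible;
  tangibleM : {in tangible &, forall a b, a * b \in tangible};
  tangibleV : {in tangible, forall a, exists2 b, b \in tangible & a * b = 1};
  tangibleC : {in tangible &, forall a b, a * b = b * a};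
  tangible_ghost0 : forall a, (a \in with_zero ghost) = (a \notin tangible);
  ghost0D : {in with_zero ghost &, forall x y, x + y \in with_zero ghost};
  ghost0Ml : forall a, {in with_zero ghost, forall x, a * x \in with_zero ghost};
  ghost0Mr : forall a, {in with_zero ghost, forall x, x * a \in with_zero ghost};
  leG_refl : {in with_zero ghost, reflexive leG};
  leG_anti : {in with_zero ghost &, antisymmetric leG};
  leG_trans : {in with_zero ghost & &, transitive leG};
  leG_total : {in with_zero ghost &, total leG};
  leGD2r : {in with_zero ghost & &,
    forall z x y, leG x y -> leG (x + z) (y + z)};
  leGM2r : {in with_zero ghost & &,
    forall z x y, leG x y -> leG (x * z) (y * z)};
  nu_ghost0 : forall a, nu a \in with_zero ghost;
  nu_idem : forall a, nu (nu a) = nu a;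
  nuMl : forall a b, nu (a * b) = nu a * b;
  nuMr : forall a b, nu (a * b) = a * nu b;
  nuM : forall a b, nu (a * b) = nu a * nu b;
  nu_tangible : forall x, x \in ghost <-> exists2 t, t \in tangible & nu t = x;
  add_gt : forall a b, leG (nu b) (nu a) -> nu b != nu a -> a + b = a;
  add_eq : forall a b, nu a = nu b -> a + b = nu a
}.

#[short(type="supertropicalSemifieldType")]
HB.structure Definition SupertropicalSemifield :=
  {F of isSupertropicalSemifield F & GRing.PzSemiRing F}.

Section Commutativity.
Variable F : supertropicalSemifieldType.

Lemma supertropical_mulC : commutative (@GRing.mul F).
Proof.
have ghostE (x : F) : x \notin tangible ->
    x = 0 \/ exists2 t, t \in @tangible F & nu t = x.
  rewrite -tangible_ghost0 => /orP[/eqP->|/nu_tangible]; [by left | by right].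
have TC (t y : F) : t \in tangible -> t * y = y * t.
  move=> Tt; have [Ty|/ghostE[->|[s Ts <-]]] := boolP (y \in @tangible F).
  - exact: tangibleC.
  - by rewrite mulr0 mul0r.
  - by rewrite -nuMr -nuMl (tangibleC t s).
move=> x y; have [Tx|/ghostE[->|[s Ts <-]]] := boolP (x \in @tangible F).
- exact: TC.
- by rewrite mulr0 mul0r.
- by rewrite -nuMl -nuMr TC.
Qed.

End Commutativity.

Section Definitions.
Variable F : supertropicalSemifieldType.
Implicit Types (a b : F) (n : nat).

Definition lt_nu a b : bool := leG (nu a) (nu b) && (nu a != nu b).

Definition dense : Prop :=
  forall a b, lt_nu b a -> exists2 u, lt_nu u 1 & lt_nu b (u * a).

Definition trop_det n (A : 'M[F]_n) : F :=
  \sum_(s : 'S_n) \prod_(i < n) A i (s i).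

Definition nonsingular n (A : 'M[F]_n) : Prop := trop_det A \in tangible.

Definition SLS n : set 'M[F]_n := [set A | trop_det A = 1].

Definition dominant n (A : 'M[F]_n) (s : 'S_n) : Prop :=
  nu (trop_det A) = nu (\prod_(i < n) A i (s i)).

Definition strictly_normal n (A : 'M[F]_n) : Prop :=
  [/\ forall s : 'S_n, dominant A s <-> s = 1%g,
      forall i, A i i = 1
    & forall i j, i != j -> lt_nu (A i j) 1].

Definition SLS1 n : set 'M[F]_n :=
  [set A | exists (s t : 'S_n) (J : 'M[F]_n),
     strictly_normal J /\ A = perm_mx s *m J *m perm_mx t].

Definition matrix_monoid n (M : set 'M[F]_n) : Prop :=
  M 1%:M /\ forall A B, M A -> M B -> M (A *m B).

Definition nonsingular_submonoid_SLS n (M : set 'M[F]_n) : Prop :=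
  [/\ matrix_monoid M, (M `<=` @SLS n)%classic
    & forall A, M A -> nonsingular A].

Definition maximal_nonsingular_submonoid_SLS n (M : set 'M[F]_n) : Prop :=
  nonsingular_submonoid_SLS M /\
  forall N : set 'M[F]_n,
    nonsingular_submonoid_SLS N -> (M `<=` N)%classic -> N = M.

End Definitions.

Arguments dense F : clear implicits.
Arguments SLS F n : clear implicits.
Arguments SLS1 F n : clear implicits.

(* Main.v *)
Require Import Defs.
From HB Require Import structures.
From mathcomp Require Import all_boot all_order all_algebra all_fingroup.
From mathcomp Require Import classical_sets.

(** Everything is compared through the preorder [le_nu] induced by [nu].  A
    matrix with unit diagonal and off-diagonal entries below the unit is called
    unit dominant; this is the same as strictly normal ([strictly_normalE]),
    because every non-identity permutation then picks up an off-diagonal factor.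
    Unit dominant matrices are closed under products, since in an entry of a
    product at most one term reaches the unit, and under conjugation by
    permutation matrices.  Pushing all permutations to the right therefore
    shows that SLS1 is the set of products [J *m perm_mx s] with [J] unit
    dominant, that it is a monoid, and that its elements have determinant 1.

    For maximality, let [N] be a nonsingular submonoid of SLS that contains
    SLS1, and let [A] be in [N].  As [trop_det A] is 1, which is tangible, it
    equals the product along a unique dominant permutation; multiplying by a
    permutation matrix makes this the identity.  Since every element of [N] has
    determinant 1, no element of [N] can have a product above 1 along any
    permutation.  Multiplying [A] by suitable elements of SLS1 turns every
    defect of [A] into such a product, or into a second dominant permutation:
    - if the entry [A i j] exceeds [A j j], density gives [u] below 1 with
      [u * A i j] still above [A j j]; multiplying on the left by the matrix
      with unit diagonal and all other entries [u] raises the [j]-th diagonal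
      entry without lowering the others ([le_diag_col]);
    - if [A i i] exceeds [A j j], the product of [A], such a matrix, and the
      conjugate of [A] by the transposition of [i] and [j] has an entry that
      contradicts the previous point ([le_diag]); hence all diagonal entries
      are [nu]-equal, and their product forces the common value to be [nu 1];
    - if [A i j] reaches the unit off the diagonal, the product of [A] with its
      conjugate by the transposition of [i] and [j] has both the identity and
      that transposition as dominant permutations ([off_diag_lt1]).
    So the diagonal of [A] is [nu]-equal to 1, hence equal to 1 because its
    entries are tangible and [nu] is injective there, and the off-diagonal
    entries are below 1: [A] is unit dominant. *)

Set Implicit Arguments.
Unset Strict Implicit.
Unset Printing Implicit Defensive.

Import GRing.Theory.
Local Open Scope ring_scope.

(** Multiplication is commutative by the axioms, so that the lemmas on big
    products in commutative semirings apply. *)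
#[non_forgetful_inheritance]
HB.instance Definition _ (F : supertropicalSemifieldType) :=
  GRing.PzSemiRing_hasCommutativeMul.Build F (@supertropical_mulC F).

(** * The preorder induced by the ghost map *)

Section NuOrder.
Variable F : supertropicalSemifieldType.
Implicit Types a b c d x y : F.

Definition le_nu a b : bool := leG (nu a) (nu b).

Lemma le_nu_total a b : le_nu a b || le_nu b a.
Proof. exact: leG_total (nu_ghost0 _) (nu_ghost0 _). Qed.

Lemma le_nu_refl a : le_nu a a.
Proof. by have := le_nu_total a a; rewrite orbb. Qed.

Lemma le_nu_trans b a c : le_nu a b -> le_nu b c -> le_nu a c.
Proof. exact: leG_trans (nu_ghost0 _) (nu_ghost0 _) (nu_ghost0 _). Qed.

Lemma le_nu_anti a b : le_nu a b -> le_nu b a -> nu a = nu b.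
Proof.
by move=> ab ba; apply: leG_anti; rewrite ?nu_ghost0 //; apply/andP.
Qed.

Lemma eq_le_nu a b : nu a = nu b -> le_nu a b.
Proof. by rewrite /le_nu => ->; apply: le_nu_refl. Qed.

Lemma lt_nuNge a b : lt_nu a b = ~~ le_nu b a.
Proof.
apply/andP/idP => [[ab]|nba].
  by apply: contra => ba; apply/eqP/le_nu_anti.
have ab : le_nu a b by have := le_nu_total a b; rewrite (negbTE nba) orbF.
split=> //; apply: contra nba => /eqP ab'; exact/eq_le_nu/esym.
Qed.

Lemma lt_nuW a b : lt_nu a b -> le_nu a b.
Proof. by case/andP. Qed.

Lemma le_lt_nu_trans b a c : le_nu a b -> lt_nu b c -> lt_nu a c.
Proof.
by move=> ab; rewrite !lt_nuNge; apply: contra => ca; apply: le_nu_trans ca ab.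
Qed.

Lemma nuD_ge a b : le_nu b a -> nu (a + b) = nu a.
Proof.
move=> ba; have [ab|ne] := eqVneq (nu a) (nu b).
  by rewrite add_eq // nu_idem.
by rewrite add_gt // eq_sym.
Qed.

Lemma le_nuDl a b : le_nu a (a + b).
Proof.
have [ab|ba] := orP (le_nu_total a b).
  by rewrite addrC /le_nu nuD_ge.
by rewrite /le_nu nuD_ge //; apply: le_nu_refl.
Qed.

Lemma nuD_cases a b : nu (a + b) = nu a \/ nu (a + b) = nu b.
Proof.
have [/nuD_ge|/nuD_ge] := orP (le_nu_total a b); last by left.
by rewrite addrC; right.
Qed.

Lemma lt_nuD a b c : lt_nu a c -> lt_nu b c -> lt_nu (a + b) c.
Proof. by rewrite /lt_nu => ac bc; case: (nuD_cases a b) => ->. Qed.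

Lemma nu0 : nu (0 : F) = 0.
Proof. by rewrite -[RHS](mul0r (nu 0)) -nuMr mul0r. Qed.

(** If [a] were strictly below 0, the dominance rule would give [0 + a = 0]. *)
Lemma le0_nu a : le_nu 0 a.
Proof.
have [//|a0] := orP (le_nu_total 0 a).
have [/eq_le_nu//|ne] := eqVneq (nu 0) (nu a).
have := @add_gt F 0 a a0; rewrite eq_sym ne add0r => ->//; exact: le_nu_refl.
Qed.

Lemma nu_tangibleF x : nu x \notin @tangible F.
Proof. by rewrite -tangible_ghost0 nu_ghost0. Qed.

Lemma tangible0F : 0 \notin @tangible F.
Proof. by rewrite -nu0 nu_tangibleF. Qed.

(** The equality rule for addition, applied to [0 + a], gives [a = nu 0]. *)
Lemma nu_eq0 a : nu a = 0 -> a = 0.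
Proof.
move=> a0; have := @add_eq F 0 a; rewrite nu0 add0r a0; exact.
Qed.

(** The order axioms allow [nu 1 = 0] at first sight; it is excluded because it
    would make the unit zero, and zero is not tangible. *)
Lemma lt_nu01 : lt_nu 0 (1 : F).
Proof.
rewrite lt_nuNge; apply/negP => /le_nu_anti/(_ (le0_nu _)).
by rewrite nu0 => /nu_eq0 e; have := @tangible1 F; rewrite e (negPf tangible0F).
Qed.

Lemma ge1_neq0 a : le_nu 1 a -> a != 0.
Proof. by apply: contraTneq => ->; rewrite -lt_nuNge lt_nu01. Qed.

(** A nonzero ghost is [nu t] with [t] tangible, so the inverse of [t] serves as
    an inverse up to [nu].  This is what makes cancellation possible in
    [le_nu_mul2r]. *)
Lemma nu_inv c : c != 0 -> exists d, nu (c * d) = nu 1.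
Proof.
move=> c0; have [/tangibleV[d _ e]|] := boolP (c \in @tangible F).
  by exists d; rewrite e.
rewrite -tangible_ghost0 => /orP[/eqP c0'|/nu_tangible[t /tangibleV[d _ e] <-]].
  by rewrite c0' eqxx in c0.
by exists d; rewrite -nuMl nu_idem e.
Qed.

Lemma le_nuM a b c d : le_nu a b -> le_nu c d -> le_nu (a * c) (b * d).
Proof.
have M2r x y z : le_nu x y -> le_nu (x * z) (y * z).
  by move=> xy; rewrite /le_nu !nuM; apply: leGM2r; rewrite ?nu_ghost0.
move=> ab cd; apply: le_nu_trans (M2r _ _ c ab) _.
by rewrite ![b * _]mulrC; apply: M2r.
Qed.

Lemma le_nu_mul2r c a b : c != 0 -> le_nu (a * c) (b * c) -> le_nu a b.
Proof.
move=> /nu_inv[d cd] /(le_nuM)/(_ (le_nu_refl d)).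
by rewrite /le_nu -!mulrA !(nuM _ (c * d)) cd -!nuM !mulr1.
Qed.

Lemma tangibleM_l a b : a * b \in tangible -> a \in @tangible F.
Proof.
apply: contraTT; rewrite -!tangible_ghost0; exact: ghost0Mr.
Qed.

Lemma tangibleD a b : a + b \in @tangible F ->
  (a + b = a /\ lt_nu b a) \/ (a + b = b /\ lt_nu a b).
Proof.
move=> Tab; have ne : nu a != nu b.
  by apply: contraTneq Tab => /add_eq->; apply: nu_tangibleF.
have [ab|ba] := orP (le_nu_total a b).
  by right; split; [rewrite addrC add_gt | rewrite /lt_nu ne andbT].
by left; split; [rewrite add_gt // eq_sym | rewrite /lt_nu eq_sym ne andbT].
Qed.

Lemma le_nu_sum (I : finType) (f : I -> F) i : le_nu (f i) (\sum_j f j).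
Proof. rewrite (bigD1 i) //=; exact: le_nuDl. Qed.

Lemma lt_nu_sum (I : finType) (P : pred I) (f : I -> F) c :
  lt_nu 0 c -> (forall i, P i -> lt_nu (f i) c) ->
  lt_nu (\sum_(i | P i) f i) c.
Proof.
move=> c0 fc; apply: (big_ind (fun x => lt_nu x c)) => // a b.
exact: lt_nuD.
Qed.

Lemma nu_sum_attained (I : finType) (f : I -> F) :
  \sum_i f i = 0 \/ exists i, nu (\sum_j f j) = nu (f i).
Proof.
apply: (big_rec (fun x => x = 0 \/ exists i, nu x = nu (f i))) =>
  [|i x _ [->|[j xj]]]; first by left.
  by right; exists i; rewrite addr0.
by right; case: (nuD_cases (f i) x) => ->; [exists i | exists j].
Qed.

(** A tie between two maximal terms of a sum makes the sum a ghost, so a tangible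
    sum equals one term that strictly dominates all the others. *)
Lemma tangible_sum (I : finType) (f : I -> F) : \sum_i f i \in @tangible F ->
  exists2 i, \sum_j f j = f i & forall j, j != i -> lt_nu (f j) (f i).
Proof.
move=> TS; have [S0|[i]] := nu_sum_attained f.
  by move: TS; rewrite S0 (negPf tangible0F).
move: TS; rewrite (bigD1 i) //= => /tangibleD[[-> lti _]|[-> + e]].
  exists i => // j ji; apply: le_lt_nu_trans lti.
  by rewrite (bigD1 j) //= le_nuDl.
by rewrite lt_nuNge (eq_le_nu e).
Qed.

Lemma le_nu_prod (I : finType) (P : pred I) (f g : I -> F) :
  (forall i, P i -> le_nu (f i) (g i)) ->
  le_nu (\prod_(i | P i) f i) (\prod_(i | P i) g i).
Proof.
move=> fg; apply: (big_ind2 (@le_nu)) => //; first exact: le_nu_refl.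
by move=> *; apply: le_nuM.
Qed.

(** Termwise comparison with equal nonzero products can have no strict term:
    cancelling the other factors leaves the comparison of the [i]-th ones. *)
Lemma le_nu_prod_eq (I : finType) (f g : I -> F) :
    (forall i, le_nu (f i) (g i)) -> \prod_i f i != 0 ->
  le_nu (\prod_i g i) (\prod_i f i) -> forall i, le_nu (g i) (f i).
Proof.
move=> fg f0 gf i; move: f0 gf.
rewrite (bigD1 i) //= (bigD1 (F := g) i) //= => f0 gf.
apply: (@le_nu_mul2r (\prod_(j | j != i) f j)).
  by apply: contraNneq f0 => ->; rewrite mulr0.
apply: le_nu_trans gf; apply: le_nuM (le_nu_refl _) _.
exact: le_nu_prod.
Qed.

Lemma prod_le1 (I : finType) (P : pred I) (f : I -> F) :
  (forall i, P i -> le_nu (f i) 1) -> le_nu (\prod_(i | P i) f i) 1.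
Proof. by move/le_nu_prod; rewrite big1_eq. Qed.

Lemma prod_ge1 (I : finType) (f : I -> F) :
  (forall i, le_nu 1 (f i)) -> le_nu 1 (\prod_i f i).
Proof.
move=> f1; have := le_nu_prod (P := predT) (fun i _ => f1 i).
by rewrite big1_eq.
Qed.

Lemma prod_lt1 (I : finType) (f : I -> F) i :
  (forall k, le_nu (f k) 1) -> lt_nu (f i) 1 -> lt_nu (\prod_k f k) 1.
Proof.
move=> f1; apply: le_lt_nu_trans; rewrite (bigD1 i) //= -[X in le_nu _ X]mulr1.
by apply: le_nuM (le_nu_refl _) (prod_le1 _).
Qed.

End NuOrder.

(** * Strictly normal matrices and the monoid SLS1 *)

Section Matrices.
Variables (F : supertropicalSemifieldType) (n : nat).
Implicit Types (A B J : 'M[F]_n) (s t : 'S_n) (u : F).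

Lemma trop_det_ge A s : le_nu (\prod_i A i (s i)) (trop_det A).
Proof. exact: (le_nu_sum (fun t => \prod_i A i (fun_of_perm t i))). Qed.

Lemma tangible_trop_det A : trop_det A \in @tangible F ->
  exists2 s : 'S_n, trop_det A = \prod_i A i (s i) &
    forall t, t != s -> lt_nu (\prod_i A i (t i)) (trop_det A).
Proof.
move=> /tangible_sum[s dA ltA]; exists s => [//|t ts].
by rewrite /trop_det dA; apply: ltA.
Qed.

Lemma mulmx_ge A B i k j : le_nu (A i k * B k j) ((A *m B) i j).
Proof. by rewrite mxE; apply: (le_nu_sum (fun k => A i k * B k j)). Qed.

Lemma mulmx_permE A s i j : (A *m perm_mx s) i j = A i (s^-1%g j).
Proof. by rewrite -[s in LHS]invgK -col_permE mxE. Qed.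

Definition perm_conj s A := perm_mx s *m A *m perm_mx s^-1.

Lemma perm_conjE s A i j : perm_conj s A i j = A (s i) (s j).
Proof. by rewrite mulmx_permE invgK -row_permE mxE. Qed.

Lemma perm_conjK s A : perm_conj s A *m perm_mx s = perm_mx s *m A.
Proof. by rewrite -mulmxA -perm_mxM mulVg perm_mx1 mulmx1. Qed.

(** Strict normality without its determinantal clause, which follows from these
    two conditions ([strictly_normalE]). *)
Definition unit_dominant J :=
  (forall i, J i i = 1) /\ (forall i j, i != j -> lt_nu (J i j) 1).

Lemma unit_dominant_lt1 J s : unit_dominant J -> s != 1%g ->
  lt_nu (\prod_i J i (s i)) 1.
Proof.
move=> [J1 Jlt] s1; have [i si] : exists i, i != s i.
  apply/existsP; apply: contraNT s1; rewrite negb_exists => /forallP si.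
  by apply/eqP/permP => i; rewrite perm1; apply/esym/eqP/negPn.
apply: (@prod_lt1 _ _ _ i) => [k|]; last exact: Jlt.
have [<-|/Jlt/lt_nuW//] := eqVneq k (s k); rewrite J1; exact: le_nu_refl.
Qed.

(** The column permutation [t] moves the dominant permutation from the identity
    to [t]; all the other permutations contribute less than 1. *)
Lemma trop_det_unit_dominant J t : unit_dominant J ->
  trop_det (J *m perm_mx t) = 1.
Proof.
move=> uJ; rewrite /trop_det (bigD1 t) //= big1 => [|i _]; last first.
  by rewrite mulmx_permE permK; case: uJ.
have /andP[rle rne] : lt_nu (\sum_(s | s != t)
    \prod_i (J *m perm_mx t) i (fun_of_perm s i)) 1.
  apply: lt_nu_sum => [|s st]; first exact: lt_nu01.
  rewrite (eq_bigr (fun i => J i ((s * t^-1)%g i))) => [|i _]; last first.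
    by rewrite mulmx_permE permM.
  by apply: unit_dominant_lt1 => //; rewrite -eq_mulgV1.
exact: add_gt.
Qed.

Lemma strictly_normalE J : strictly_normal J <-> unit_dominant J.
Proof.
split=> [[_ J1 Jlt]|uJ]; first by split.
have [J1 Jlt] := uJ; split=> // s.
have -> : dominant J s <-> nu (1 : F) = nu (\prod_i J i (s i)).
  rewrite /dominant -[in trop_det J](mulmx1 J) -perm_mx1.
  by rewrite trop_det_unit_dominant.
split=> [e|->]; last by rewrite big1 // => i _; rewrite perm1.
apply/eqP; apply: contraTT isT => /(unit_dominant_lt1 uJ).
by rewrite lt_nuNge (eq_le_nu e).
Qed.

Lemma unit_dominant1 : unit_dominant 1%:M.
Proof.
by split=> [i|i j ij]; rewrite mxE ?eqxx // (negPf ij) lt_nu01.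
Qed.

Lemma unit_dominant_conj s J : unit_dominant J -> unit_dominant (perm_conj s J).
Proof.
move=> [J1 Jlt]; split=> [i|i j ij]; rewrite perm_conjE ?J1 //.
by apply: Jlt; rewrite (inj_eq perm_inj).
Qed.

Lemma lt_nuM1 (a b : F) : lt_nu a 1 -> le_nu b 1 -> lt_nu (a * b) 1.
Proof.
move=> a1 b1; apply: le_lt_nu_trans a1; rewrite -[X in le_nu _ X]mulr1.
exact: le_nuM (le_nu_refl _) b1.
Qed.

(** In the sum defining an entry of the product, the only term that can be as
    large as the unit is [J i i * J' i i], on the diagonal. *)
Lemma unit_dominantM J J' :
  unit_dominant J -> unit_dominant J' -> unit_dominant (J *m J').
Proof.
move=> [J1 Jlt] [J'1 J'lt].
have J'le i j : le_nu (J' i j) 1.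
  by have [->|/J'lt/lt_nuW//] := eqVneq i j; rewrite J'1 le_nu_refl.
split=> [i|i j ij]; rewrite mxE.
  rewrite (bigD1 i) //= J1 J'1 mulr1.
  have /andP[? ?] : lt_nu (\sum_(k | k != i) J i k * J' k i) 1.
    apply: lt_nu_sum => [|k ki]; first exact: lt_nu01.
    by apply: lt_nuM1 => //; apply: Jlt; rewrite eq_sym.
  exact: add_gt.
apply: lt_nu_sum => [|k _]; first exact: lt_nu01.
have [<-|/Jlt ik] := eqVneq i k; first by rewrite J1 mul1r J'lt.
exact: lt_nuM1.
Qed.

(** A left permutation factor is moved to the right at the cost of conjugating
    the strictly normal factor. *)
Lemma SLS1E A :
  SLS1 F n A <-> exists s J, unit_dominant J /\ A = J *m perm_mx s.
Proof.
split=> [[s [t [J [/strictly_normalE uJ ->]]]]|[s [J [uJ ->]]]].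
  exists (s * t)%g, (perm_conj s J); split; first exact: unit_dominant_conj.
  by rewrite perm_mxM mulmxA perm_conjK.
exists 1%g, s, J; rewrite perm_mx1 mul1mx; split=> //.
exact/strictly_normalE.
Qed.

Lemma SLS1_unit_dominant J : unit_dominant J -> SLS1 F n J.
Proof. by move=> uJ; apply/SLS1E; exists 1%g, J; rewrite perm_mx1 mulmx1. Qed.

Lemma SLS1_perm s : SLS1 F n (perm_mx s).
Proof.
apply/SLS1E; exists s, 1%:M; rewrite mul1mx; split=> //.
exact: unit_dominant1.
Qed.

Lemma SLS1_nonsingular_submonoid : nonsingular_submonoid_SLS (SLS1 F n).
Proof.
have det1 A : SLS1 F n A -> trop_det A = 1.
  by move=> /SLS1E[s [J [uJ ->]]]; apply: trop_det_unit_dominant.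
split=> [||A /det1]; last by rewrite /nonsingular => ->; apply: tangible1.
- split; first exact/SLS1_unit_dominant/unit_dominant1.
  move=> A B /SLS1E[s [J [uJ ->]]] /SLS1E[t [J' [uJ' ->]]]; apply/SLS1E.
  exists (s * t)%g, (J *m perm_conj s J').
  split; first exact/unit_dominantM/unit_dominant_conj.
  by rewrite perm_mxM -!mulmxA; congr (_ *m _); rewrite !mulmxA perm_conjK.
- by move=> A /det1.
Qed.

Definition off_diag u : 'M[F]_n := \matrix_(i, j) if i == j then 1 else u.

Lemma unit_dominant_off_diag u : lt_nu u 1 -> unit_dominant (off_diag u).
Proof. by move=> u1; split=> [i|i j ij]; rewrite mxE ?eqxx // (negPf ij). Qed.

End Matrices.

(** * Nonsingular monoids that contain SLS1 *)

Section Maximality.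
Variables (F : supertropicalSemifieldType) (n : nat).
Variable N : set 'M[F]_n.
Hypothesis N_mul : forall A B, N A -> N B -> N (A *m B).
Hypothesis N_SLS : forall A, N A -> trop_det A = 1.
Hypothesis SLS1_N : forall A, SLS1 F n A -> N A.
Hypothesis F_dense : dense F.
Implicit Types A B : 'M[F]_n.

Lemma monoid_unit_dominant J : unit_dominant J -> N J.
Proof. by move/SLS1_unit_dominant/SLS1_N. Qed.

Lemma monoid_perm_conj s A : N A -> N (perm_conj s A).
Proof. by move=> NA; do 2?apply: N_mul => //; exact/SLS1_N/SLS1_perm. Qed.

(** The diagonal product of an element of [N] is at most its determinant, which
    is 1.  A family whose product is at least 1 and which lies below the diagonal
    must then agree with it up to [nu].  Applied to well chosen products of
    elements of [N], this bounds the entries of the factors. *)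
Lemma diag_le_of_minorant A (d : 'I_n -> F) : N A ->
    (forall k, le_nu (d k) (A k k)) -> le_nu 1 (\prod_k d k) ->
  forall k, le_nu (A k k) (d k).
Proof.
move=> NA dA d1; apply: le_nu_prod_eq => //; first exact: ge1_neq0.
apply: le_nu_trans d1; have := trop_det_ge A 1%g; rewrite (N_SLS NA).
by under eq_bigr => k _ do rewrite perm1.
Qed.

(** By density, a strict excess of [A i j] over [A j j] survives multiplication
    by some [u] below 1, and such a [u] is allowed as an off-diagonal entry of
    an element of SLS1. *)
Lemma le_diag_col A i j : N A -> le_nu 1 (\prod_k A k k) ->
  le_nu (A i j) (A j j).
Proof.
move=> NA A1; have [->|ij] := eqVneq i j; first exact: le_nu_refl.
have [//|] := boolP (le_nu (A i j) (A j j)); rewrite -lt_nuNge.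
move=> /F_dense[u /unit_dominant_off_diag uJ].
rewrite lt_nuNge => /negP[].
have NJA : N (off_diag n u *m A).
  by apply: N_mul => //; apply: monoid_unit_dominant.
have JA k : le_nu (A k k) ((off_diag n u *m A) k k).
  by have := mulmx_ge (off_diag n u) A k k k; rewrite mxE eqxx mul1r.
apply: le_nu_trans (diag_le_of_minorant NJA JA A1 j).
have := mulmx_ge (off_diag n u) A j i j.
by rewrite mxE eq_sym (negPf ij).
Qed.

(** Conjugating by the transposition of [i] and [j] exchanges [A i i] and
    [A j j].  In [A *m off_diag n u *m A'] the [j]-th diagonal entry is then
    [A j j * A i i] by the minorant argument, while the entry at [(i, j)] is at
    least [A i i * u * A i i].  As the former dominates its column
    ([le_diag_col]), cancelling [A i i] gives [u * A i i <= A j j], against the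
    choice of [u]. *)
Lemma le_diag A i j : N A -> le_nu 1 (\prod_k A k k) -> le_nu (A i i) (A j j).
Proof.
move=> NA A1; have [->|ij] := eqVneq i j; first exact: le_nu_refl.
have [//|] := boolP (le_nu (A i i) (A j j)); rewrite -lt_nuNge => Aji.
have [u /unit_dominant_off_diag uJ] := F_dense Aji; rewrite lt_nuNge => /negP[].
have Ai0 : A i i != 0.
  by apply: contraTneq Aji => ->; rewrite lt_nuNge le0_nu.
set A' := perm_conj (tperm i j) A; pose AJ := A *m off_diag n u.
have NC : N (AJ *m A').
  apply: N_mul; last exact: monoid_perm_conj.
  by apply: N_mul => //; apply: monoid_unit_dominant.
have C1 : le_nu 1 (\prod_k (A k k * A' k k)).
  rewrite big_split /= -[X in le_nu X _]mulr1; apply: le_nuM => //.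
  under eq_bigr => k _ do rewrite perm_conjE.
  by move: A1; rewrite (reindex_perm (tperm i j)).
have AJge k l : le_nu (A k k * off_diag n u k l) (AJ k l) by apply: mulmx_ge.
have dC k : le_nu (A k k * A' k k) ((AJ *m A') k k).
  apply: le_nu_trans (mulmx_ge _ _ k k k); apply: le_nuM (le_nu_refl _).
  by have := AJge k k; rewrite mxE eqxx mulr1.
(* [A i i * (u * A i i) <= A i i * A j j] follows from these two bounds. *)
have Cjj := diag_le_of_minorant NC dC C1 j.
have Cij : le_nu ((AJ *m A') i j) ((AJ *m A') j j).
  apply: le_diag_col => //; apply: le_nu_trans C1 _; exact: le_nu_prod.
have A'jj : A' j j = A i i by rewrite perm_conjE tpermR.
apply: (le_nu_mul2r Ai0).
apply: le_nu_trans (_ : le_nu _ (A j j * A' j j)) _; last first.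
  rewrite A'jj; exact: le_nu_refl.
apply: le_nu_trans Cjj; apply: le_nu_trans Cij.
apply: le_nu_trans (mulmx_ge _ _ i j j); rewrite A'jj.
apply: le_nuM (le_nu_refl _).
by have := AJge i j; rewrite mxE (negPf ij) mulrC.
Qed.

(** The diagonal entries being [nu]-equal, one below 1 would bring their product
    below 1; so the constant 1 is a minorant of the diagonal. *)
Lemma diag_nu1 A i : N A -> le_nu 1 (\prod_k A k k) -> nu (A i i) = nu 1.
Proof.
move=> NA A1.
have Age k : le_nu 1 (A k k).
  have [//|] := boolP (le_nu 1 (A k k)); rewrite -lt_nuNge => Ak.
  have : lt_nu (\prod_k A k k) 1.
    apply: (@prod_lt1 _ _ _ k) => // l.
    exact: le_nu_trans (le_diag l k NA A1) (lt_nuW Ak).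
  by rewrite lt_nuNge A1.
apply: le_nu_anti (Age i); apply: (diag_le_of_minorant (d := fun=> 1) NA) => //.
by rewrite big1 // le_nu_refl.
Qed.

(** If [A i j] is not below 1, the conjugate by the transposition of [i] and [j]
    has such an entry at [(j, i)], so in the product of [A] with this conjugate
    the identity and the transposition both reach the determinant, which is
    therefore a ghost. *)
Lemma off_diag_lt1 A i j : N A -> le_nu 1 (\prod_k A k k) -> i != j ->
  lt_nu (A i j) 1.
Proof.
move=> NA A1 ij; have [//|] := boolP (lt_nu (A i j) 1).
rewrite lt_nuNge negbK => Aij; set s := tperm i j.
have NB : N (A *m perm_conj s A) by apply: N_mul => //; apply: monoid_perm_conj.
have Akk k : le_nu 1 (A k k) by apply/eq_le_nu/esym/diag_nu1.
have Bge k l m : le_nu 1 (A k m) -> le_nu 1 (A (s m) (s l)) ->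
    le_nu 1 ((A *m perm_conj s A) k l).
  move=> Akm Aml; apply: le_nu_trans (mulmx_ge _ _ k m l).
  by rewrite perm_conjE -[X in le_nu X _]mulr1; apply: le_nuM.
have TB : trop_det (A *m perm_conj s A) \in tangible.
  by rewrite N_SLS // tangible1.
have [r _ rB] := tangible_trop_det TB; rewrite N_SLS // in rB.
have dom (t : 'S_n) : le_nu 1 (\prod_k (A *m perm_conj s A) k (t k)) -> t = r.
  by move=> tB; apply/eqP; apply: contraTT tB => /rB; rewrite lt_nuNge.
have r1 : 1%g = r.
  by apply: dom; apply: prod_ge1 => k; rewrite perm1; apply: (Bge _ _ k).
have rs : s = r.
  apply: dom; apply: prod_ge1 => k; rewrite /s.
  case: tpermP => [->|->|_ _].
  (* Both off-diagonal products pass through the middle index [j]. *)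
  - by apply: (Bge _ _ j).
  - by apply: (Bge _ _ j) => //; rewrite /s tpermL tpermR.
  - exact: (Bge _ _ k).
have := tpermL i j; rewrite -/s rs -r1 perm1 => e.
by rewrite e eqxx in ij.
Qed.

Lemma monoid_sub_SLS1 (nu_inj : {in @tangible F &, injective (@nu F)}) A :
  N A -> SLS1 F n A.
Proof.
move=> NA; have TA : trop_det A \in tangible by rewrite N_SLS // tangible1.
have [s As _] := tangible_trop_det TA.
pose J := A *m perm_mx s^-1.
have Jkk k : J k k = A k (s k) by rewrite mulmx_permE invgK.
have NJ : N J by apply: N_mul => //; exact/SLS1_N/SLS1_perm.
have J1 : le_nu 1 (\prod_k J k k).
  under eq_bigr => k _ do rewrite Jkk.
  by rewrite -As N_SLS // le_nu_refl.
apply/SLS1E; exists s, J; split; last first.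
  by rewrite -mulmxA -perm_mxM mulVg perm_mx1 mulmx1.
split=> [i|i j]; last exact: off_diag_lt1.
apply: nu_inj; [|exact: tangible1|exact: diag_nu1].
by rewrite Jkk; move: TA; rewrite As (bigD1 i) //=; apply: tangibleM_l.
Qed.

End Maximality.

Theorem theorem3p19 (F : supertropicalSemifieldType) (n : nat)
    (nu_inj : {in @tangible F &, injective (@nu F)})
    (F_dense : dense F) :
  maximal_nonsingular_submonoid_SLS (SLS1 F n).
Proof.
split; first exact: SLS1_nonsingular_submonoid.
move=> N [[_ N_mul] N_SLS _] SLS1_N; apply/seteqP; split=> //.
by move=> A NA; apply: (@monoid_sub_SLS1 F n N).
Qed.
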